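(* Let $m,n,k,r$ be positive integers with $r\le\min\{m,n\}$, and assume $r>k$. Let $A=(A_1\;\;A_2)\in\mathbb{R}^{m\times n}$ with $A_1\in\mathbb{R}^{m\times k}$ and $A_2\in\mathbb{R}^{m\times (n-k)}$, and let $W_1\in\mathbb{R}^{m\times k}$ satisfy $(W_1)_{ij}>0$ for all $i,j$. If $(\hat{X}_1,\hat{X}_2)$, with $\hat X_1\in\mathbb{R}^{m\times k}$ and $\hat X_2\in\mathbb{R}^{m\times(n-k)}$, is a solution (global minimizer) of $$\min_{\substack{X_1\in\mathbb{R}^{m\times k},\;X_2\in\mathbb{R}^{m\times(n-k)}\\ \operatorname{rank}(X_1\;\;X_2)\le r}}\left\{\|(A_1-X_1)\odot W_1\|_F^2+\|A_2-X_2\|_F^2\right\},$$ then $$\hat{X}_2=P_{\hat{X}_1}(A_2)+H_{r-k}\left(P^{\perp}_{\hat{X}_1}(A_2)\right).$$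
   Context: $\|\cdot\|_F$ is the Frobenius norm, $\odot$ is the entrywise (Hadamard) product of matrices, and $(X_1\;\;X_2)$ denotes the matrix obtained by placing the columns of $X_1$ and then those of $X_2$ side by side. For a matrix $B$ with $m$ rows, $P_B$ and $P_B^{\perp}$ are the orthogonal projections of $\mathbb{R}^m$ onto the column space of $B$ and onto its orthogonal complement, respectively, applied to a matrix column by column. For a nonnegative integer $s$ and a matrix $M$, the hard-thresholding operator is $H_s(M)=U\Sigma_sV^T$, where $M=U\Sigma V^T$ is a singular value decomposition of $M$ and $\Sigma_s$ is the diagonal matrix obtained from $\Sigma$ by keeping only the $s$ largest entries and replacing the others by $0$.
   Formalization: The formal theorem also assumes that X̂_1 has full column rank k; without this the claim fails, e.g. for m=2, n=3, k=1, r=2, A_1=0, A_2=I_2, W_1 all ones. H_{r-k} is taken for some singular value decomposition when singular values tie. *)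

(* Defs.v *)
From HB Require Import structures.
From mathcomp Require Export all_boot all_order all_algebra.
From mathcomp Require Export reals.

Set Implicit Arguments.
Unset Strict Implicit.
Unset Printing Implicit Defensive.

Import Order.TTheory GRing.Theory Num.Theory.
Local Open Scope ring_scope.

Definition frobenius_norm (R : realType) (p q : nat) (M : 'M[R]_(p, q)) : R :=
  Num.sqrt (\sum_(i < p) \sum_(j < q) M i j ^+ 2).

Definition hadamard (R : realType) (p q : nat) (M N : 'M[R]_(p, q)) :
    'M[R]_(p, q) :=
  map2_mx *%R M N.

(* MathComp subspaces are row spaces: the column space of [B] is the row space
   of [B^T], and its orthogonal complement is [kermx B], the row vectors [u]
   with [u *m B = 0]. Likewise [proj_mx] acts on rows from the right, hence the
   outer transpositions. *)
Definition proj_col (R : realType) (m p q : nat)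
    (B : 'M[R]_(m, p)) (M : 'M[R]_(m, q)) : 'M[R]_(m, q) :=
  (M^T *m proj_mx <<B^T>>%MS (kermx B))^T.

Definition proj_col_perp (R : realType) (m p q : nat)
    (B : 'M[R]_(m, p)) (M : 'M[R]_(m, q)) : 'M[R]_(m, q) :=
  (M^T *m proj_mx (kermx B) <<B^T>>%MS)^T.

(* Full singular value decomposition [M = U *m S *m V^T]; [S] is rectangular,
   with its diagonal listed in nonincreasing order. *)
Definition is_svd (R : realType) (p q : nat) (M : 'M[R]_(p, q))
    (U : 'M[R]_p) (S : 'M[R]_(p, q)) (V : 'M[R]_q) : Prop :=
  [/\ U^T *m U = 1%:M,
      V^T *m V = 1%:M,
      is_diag_mx S
        /\ (forall (i : 'I_p) (j : 'I_q), i = j :> nat -> 0 <= S i j),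
      (forall (i i' : 'I_p) (j j' : 'I_q),
          i = j :> nat -> i' = j' :> nat -> (i <= i')%N -> S i' j' <= S i j)
    & M = U *m S *m V^T].

Definition truncate_diag (R : realType) (p q s : nat) (S : 'M[R]_(p, q)) :
    'M[R]_(p, q) :=
  \matrix_(i, j) (if (i < s)%N then S i j else 0).

(* [N] is a value of H_s(M). This is a relation because, when the s-th and
   (s+1)-st singular values of [M] coincide and are nonzero, H_s(M) depends on
   the choice of the decomposition. *)
Definition hard_threshold (R : realType) (p q s : nat) (M N : 'M[R]_(p, q)) :
    Prop :=
  exists (U : 'M[R]_p) (S : 'M[R]_(p, q)) (V : 'M[R]_q),
    is_svd M U S V /\ N = U *m truncate_diag s S *m V^T.

Definition wlra_cost (R : realType) (m k l : nat)
    (A1 W1 : 'M[R]_(m, k)) (A2 : 'M[R]_(m, l))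
    (X1 : 'M[R]_(m, k)) (X2 : 'M[R]_(m, l)) : R :=
  frobenius_norm (hadamard (A1 - X1) W1) ^+ 2 + frobenius_norm (A2 - X2) ^+ 2.

Definition is_wlra_solution (R : realType) (m k l r : nat)
    (A1 W1 : 'M[R]_(m, k)) (A2 : 'M[R]_(m, l))
    (X1 : 'M[R]_(m, k)) (X2 : 'M[R]_(m, l)) : Prop :=
  (\rank (row_mx X1 X2) <= r)%N /\
  (forall (Y1 : 'M[R]_(m, k)) (Y2 : 'M[R]_(m, l)),
      (\rank (row_mx Y1 Y2) <= r)%N ->
      wlra_cost A1 W1 A2 X1 X2 <= wlra_cost A1 W1 A2 Y1 Y2).

(* Main.v *)
Require Import Defs.
From mathcomp Require Import all_boot all_order all_algebra reals.
From mathcomp Require Import perm ring lra zify.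
From mathcomp Require Import boolp classical_sets topology normedtype derive.
Import Order.TTheory GRing.Theory Num.Theory.
Import numFieldNormedType.Exports.
Local Open Scope ring_scope.

Set Implicit Arguments.
Unset Strict Implicit.
Unset Printing Implicit Defensive.

(** Keep [X1] fixed and vary [X2] only: the weighted term of the cost is then
    constant. Split [A2 = X1 L + B] and [X2 = X1 L2 + H] along the column space
    of [X1] and its orthogonal complement ([proj_colP]). Since [X1] has rank
    [k], the constraint [rank (X1 X2) <= r] says exactly that [H] has rank at
    most [r - k] ([mxrank_row_mx_perp]), and by Pythagoras ([sqnorm_perp])
    the cost is [|X1 (L - L2)|^2 + |B - H|^2] up to a constant. Comparing with
    the competitors [X1 L + Z], where [Z] has rank at most [r - k], gives
    [X1 L2 = X1 L], which is the projection of [A2], and shows that [H] is a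
    best approximation of [B] of rank at most [r - k].

    What remains is the equality case of the Eckart-Young theorem
    ([best_approx_hard_threshold]): every best approximation [H] of [B] of rank
    at most [s] is the truncation of some singular value decomposition of [B],
    even when tied singular values make [H] non-unique. The idea is to break
    the ties: by a parallelogram identity, [2 H] is the only best approximation
    of [B + H] ([best_approx_double]). Take a singular value decomposition
    [U S V^T] of [B + H]. Uniqueness forces [2 H] to be invariant under the
    sign changes that preserve [S], hence diagonal in the bases [U], [V], and a
    rearrangement inequality then identifies it with the truncation of [S]
    ([unique_best_approx_truncate]). Subtracting [H] halves the first [s]
    diagonal entries of [S] and leaves the others alone, so that [U] and [V]
    also diagonalize [B]; the halved entries still dominate the others, since
    otherwise exchanging two of them would improve on [H].

    Singular value decompositions ([svd_exists]) are obtained by maximizing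
    [tr (D^T U^T M V)] over the compact set of pairs of orthogonal matrices,
    where [D] is diagonal with strictly decreasing positive entries: at a
    maximum, first-order conditions make [U^T M V] diagonal, and sign changes
    and transpositions make its diagonal nonnegative and nonincreasing. *)

(** * Orthogonal matrices and reflections *)

Definition orthogonal_mx (R : realType) (p : nat) (U : 'M[R]_p) : Prop :=
  U^T *m U = 1%:M.

Lemma orthogonal_mxV (R : realType) (p : nat) (U : 'M[R]_p) :
  orthogonal_mx U -> U *m U^T = 1%:M.
Proof. exact: mulmx1C. Qed.

Lemma orthogonal_mx_tr (R : realType) (p : nat) (U : 'M[R]_p) :
  orthogonal_mx U -> orthogonal_mx U^T.
Proof. by move=> oU; rewrite /orthogonal_mx trmxK orthogonal_mxV. Qed.

Lemma orthogonal_mx1 (R : realType) (p : nat) : orthogonal_mx (1%:M : 'M[R]_p).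
Proof. by rewrite /orthogonal_mx trmx1 mulmx1. Qed.

Lemma orthogonal_mxM (R : realType) (p : nat) (U V : 'M[R]_p) :
  orthogonal_mx U -> orthogonal_mx V -> orthogonal_mx (U *m V).
Proof.
move=> oU oV; rewrite /orthogonal_mx trmx_mul mulmxA -[_ *m U^T *m U]mulmxA.
by rewrite oU mulmx1 oV.
Qed.

Lemma tperm_mx_orthogonal (R : realType) (p : nat) (i j : 'I_p) :
  orthogonal_mx (tperm_mx i j : 'M[R]_p).
Proof.
by rewrite /orthogonal_mx tr_tperm_mx /tperm_mx -perm_mxM tperm2 perm_mx1.
Qed.

Definition reflection_mx (R : realType) (p : nat) (v : 'cV[R]_p) : 'M[R]_p :=
  1%:M - (2 / (v^T *m v) 0 0) *: (v *m v^T).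

Lemma reflection_mx_orthogonal (R : realType) (p : nat) (v : 'cV[R]_p) :
  (v^T *m v) 0 0 != 0 -> orthogonal_mx (reflection_mx v).
Proof.
rewrite /orthogonal_mx /reflection_mx; set a := (v^T *m v) 0 0 => a_neq0.
have -> : (1%:M - (2 / a) *: (v *m v^T))^T = 1%:M - (2 / a) *: (v *m v^T).
  by rewrite linearB /= trmx1 linearZ /= trmx_mul trmxK.
have vv : v *m v^T *m (v *m v^T) = a *: (v *m v^T).
  rewrite mulmxA -[v *m v^T *m v]mulmxA [v^T *m v]mx11_scalar -/a.
  by rewrite mul_mx_scalar scalemxAl.
rewrite mulmxBl mul1mx mulmxBr mulmx1.
rewrite -scalemxAr -scalemxAl vv !scalerA.
set b := 2 / a; have -> : b * b * a = 2 * b by rewrite /b; field.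
by rewrite mulrDl mul1r scalerDl opprB addrK subrK.
Qed.

(** The reflection in [e_i] gives [0 <= K i i]. The product of the reflections
    in [e_i + t e_j] and [e_i] is a rotation that moves the trace by a multiple
    of [t (K i j - K j i) - t^2 (K i i + K j j)]; this is nonpositive for all
    [t] only if [K i j = K j i]. *)
Lemma trace_max_sym (R : realType) (p : nat) (K : 'M[R]_p) :
    (forall Q, orthogonal_mx Q -> \tr (K *m Q) <= \tr K) ->
  K^T = K /\ forall i, 0 <= K i i.
Proof.
move=> maxK.
have trE (v w : 'cV[R]_p) (N : 'M[R]_p) :
    \tr (N *m (v *m w^T)) = (w^T *m N *m v) 0 0.
  by rewrite mulmxA mxtrace_mulC mulmxA trace_mx11.
have trB (M N : 'M[R]_p) : \tr (M - N) = \tr M - \tr N by exact: raddfB.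
pose e i : 'cV[R]_p := delta_mx i 0.
have eE i j (N : 'M[R]_p) : ((e i)^T *m N *m e j) 0 0 = N i j.
  by rewrite trmx_delta -rowE -colE !mxE.
have ee i j : ((e i)^T *m e j) 0 0 = (i == j)%:R.
  by rewrite -[(e i)^T]mulmx1 eE mxE.
have diag_ge0 i : 0 <= K i i.
  have /maxK : orthogonal_mx (reflection_mx (e i)).
    by apply: reflection_mx_orthogonal; rewrite ee eqxx oner_eq0.
  rewrite /reflection_mx ee eqxx divr1 mulmxBr mulmx1 -scalemxAr.
  by rewrite trB mxtraceZ trE eE; lra.
split=> //; apply/matrixP => i j; rewrite mxE.
have [->//|ij] := eqVneq i j.
pose w t : 'cV[R]_p := e i + t *: e j.
have wE (u : 'cV[R]_p) N t : ((w t)^T *m N *m u) 0 0 = ((e i)^T *m N *m u) 0 0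
     + t * ((e j)^T *m N *m u) 0 0.
  by rewrite linearD /= linearZ /= !mulmxDl -!scalemxAl !mxE.
have Ew (u : 'cV[R]_p) N t : (u^T *m N *m w t) 0 0 = (u^T *m N *m e i) 0 0
     + t * (u^T *m N *m e j) 0 0.
  by rewrite mulmxDr -scalemxAr !mxE.
have key t : t * (K i j - K j i) <= t ^+ 2 * (K i i + K j j).
  have ww : ((w t)^T *m w t) 0 0 = 1 + t ^+ 2.
    rewrite -[(w t)^T]mulmx1 wE !Ew !eE !mxE !eqxx (negPf ij) eq_sym (negPf ij).
    by rewrite !mulr1n !mulr0n; ring.
  have t1 : 0 < 1 + t ^+ 2 by rewrite ltr_wpDr ?sqr_ge0.
  have /maxK : orthogonal_mx (reflection_mx (w t) *m reflection_mx (e i)).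
    apply: orthogonal_mxM; apply: reflection_mx_orthogonal.
      by rewrite ww gt_eqF.
    by rewrite ee eqxx oner_eq0.
  rewrite /reflection_mx ww ee eqxx divr1.
  have we : (w t)^T *m e i = 1%:M.
    rewrite [LHS]mx11_scalar -[(w t)^T]mulmx1 wE !mulmx1 !ee.
    by rewrite eqxx eq_sym (negPf ij) mulr1n mulr0n mulr0 addr0.
  have wwee : w t *m (w t)^T *m (e i *m (e i)^T) = w t *m (e i)^T.
    by rewrite mulmxA -[w t *m _ *m e i]mulmxA we mulmx1.
  set al := 2 / _.
  rewrite [X in K *m X]mulmxBl mul1mx -scalemxAl [X in al *: X]mulmxBr mulmx1.
  rewrite -scalemxAr wwee !mulmxBr mulmx1 -!scalemxAr mulmxBr -scalemxAr.
  rewrite !(trB, mxtraceZ) !trE !wE !Ew !eE /al.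
  rewrite -subr_ge0 => H.
  rewrite -subr_ge0.
  have := mulr_ge0 (ltW t1) H.
  set X := (X in 0 <= X -> _).
  suff -> : X = 2 * (t ^+ 2 * (K i i + K j j) - t * (K i j - K j i)) by lra.
  by rewrite /X; field; rewrite gt_eqF.
have [a0|] := eqVneq (K i j - K j i) 0.
  by apply/eqP; rewrite eq_sym -subr_eq0 a0.
set a := K i j - K j i in key * => a0.
have b0 : 0 <= K i i + K j j by rewrite addr_ge0.
move: b0 key; set b := K i i + K j j => b0 key.
have b1 : 0 < b + 1 by lra.
(* [b + 1] instead of the optimal [2 b], which may vanish. *)
have := key (a / (b + 1)).
have -> : a / (b + 1) * a = a ^+ 2 * (b + 1) / (b + 1) ^+ 2.
  by field; rewrite gt_eqF.
have -> : (a / (b + 1)) ^+ 2 * b = a ^+ 2 * b / (b + 1) ^+ 2.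
  by field; rewrite gt_eqF.
rewrite ler_pM2r ?invr_gt0 ?exprn_gt0 // ler_pM2l; first lra.
by rewrite lt_neqAle sqr_ge0 andbT eq_sym sqrf_eq0.
Qed.

(** * First-order conditions for a singular value decomposition *)

(** The conditions that [is_svd] puts on the middle factor. *)
Definition singular_value_mx (R : realType) (p q : nat)
    (S : 'M[R]_(p, q)) : Prop :=
  [/\ is_diag_mx S,
      forall (i : 'I_p) (j : 'I_q), i = j :> nat -> 0 <= S i j
    & forall (i i' : 'I_p) (j j' : 'I_q),
        i = j :> nat -> i' = j' :> nat -> (i <= i')%N -> S i' j' <= S i j].

(** Any positive, strictly decreasing diagonal would do: distinct weights are
    what separates the singular directions and sorts the singular values. *)
Definition weight_mx (R : realType) (p q : nat) : 'M[R]_(p, q) :=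
  \matrix_(i, j) if i == j :> nat then (p + q - i)%:R else 0.

Lemma weight_mx_tr (R : realType) (p q : nat) :
  (weight_mx R p q)^T = weight_mx R q p.
Proof.
apply/matrixP => i j; rewrite !mxE eq_sym.
by case: eqP => // ->; rewrite addnC.
Qed.

Lemma weight_mx_gram (R : realType) (p q : nat) :
  (weight_mx R p q)^T *m weight_mx R p q
  = diag_mx (\row_j if (j < p)%N then (p + q - j)%:R ^+ 2 else 0).
Proof.
apply/matrixP => i j; rewrite !mxE.
have [ip|pi] := ltnP i p; last first.
  rewrite [RHS]mul0rn big1 // => a _; rewrite !mxE.
  have /negPf-> : (a != i :> nat)%N.
    by rewrite neq_ltn (leq_trans (ltn_ord a) pi).
  by rewrite mul0r.
rewrite (bigD1 (Ordinal ip)) //= !mxE eqxx big1 ?addr0 => [|a a_neq].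
  rewrite -val_eqE /=; case: eqP => [->|_]; last by rewrite mulr0 mulr0n.
  by rewrite mulr1n expr2.
rewrite !mxE; have /negPf-> : (a != i :> nat)%N.
  by apply: contra a_neq => /eqP ai; apply/eqP/val_inj.
by rewrite mul0r.
Qed.

(** Varying one factor at a time, maximality makes [N D^T] and [D^T N]
    symmetric, hence [N (D^T D) = (D D^T) N]; as [D^T D] and [D D^T] are
    diagonal with distinct entries at unequal positions, [N] is diagonal.
    Swapping two positions on both sides then compares diagonal entries. *)
Lemma trace_max_singular_value_mx (R : realType) (p q : nat)
    (N : 'M[R]_(p, q)) :
    (forall Q Q', orthogonal_mx Q -> orthogonal_mx Q' ->
       \tr ((weight_mx R p q)^T *m (Q *m N *m Q'))
         <= \tr ((weight_mx R p q)^T *m N)) ->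
  singular_value_mx N.
Proof.
set D := weight_mx R p q => maxN.
have [symL geL] : (N *m D^T)^T = N *m D^T /\ forall i, 0 <= (N *m D^T) i i.
  apply: trace_max_sym => Q oQ.
  have := maxN Q 1%:M oQ (orthogonal_mx1 _ _).
  by rewrite mulmx1 !(mxtrace_mulC D^T) -[Q *m N *m _]mulmxA (mxtrace_mulC Q).
have [symR _] : (D^T *m N)^T = D^T *m N /\ forall i, 0 <= (D^T *m N) i i.
  apply: trace_max_sym => Q oQ.
  by have := maxN 1%:M Q (orthogonal_mx1 _ _) oQ; rewrite mul1mx mulmxA.
rewrite !trmx_mul !trmxK in symL symR.
have comm : N *m (D^T *m D) = D *m D^T *m N.
  by rewrite mulmxA -symL -[LHS]mulmxA symR mulmxA.
have DDt : D *m D^T = (weight_mx R q p)^T *m weight_mx R q p.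
  by rewrite /D !weight_mx_tr.
rewrite DDt !weight_mx_gram mul_diag_mx mul_mx_diag in comm.
have diagN : forall (i : 'I_p) (j : 'I_q), i != j :> nat -> N i j = 0.
  move=> i j ij; move/matrixP/(_ i j): comm; rewrite !mxE => /eqP.
  rewrite -subr_eq0 mulrC -mulrBl mulf_eq0 => /orP[|/eqP//].
  rewrite subr_eq0.
  have sq0 (n : nat) : (0 < n)%N -> (n%:R ^+ 2 == 0 :> R) = false.
    by move=> n0; apply: negbTE; rewrite expf_eq0 /= pnatr_eq0 -lt0n.
  have := ltn_ord i; have := ltn_ord j.
  case: (ltnP j p) => jp; case: (ltnP i q) => iq jq ip.
  - by rewrite eqrXn2 ?ler0n // eqr_nat => /eqP; lia.
  - by rewrite sq0 //; lia.
  - by rewrite eq_sym sq0 //; lia.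
  - lia.
have DN (T : 'M[R]_(p, q)) : \tr (D^T *m T) = \sum_i \sum_j D i j * T i j.
  rewrite mxtrace_mulC /mxtrace; apply: eq_bigr => i _; rewrite mxE.
  by apply: eq_bigr => j _; rewrite mxE mulrC.
split.
- by apply/is_diag_mxP => i j; exact: diagN.
- move=> i j ij; have := geL i.
  rewrite mxE (bigD1 j) //= big1 ?addr0; last first.
    move=> l lj; rewrite diagN ?mul0r // ij eq_sym.
    by apply: contra lj => /eqP jl; apply/eqP/val_inj.
  by rewrite !mxE ij eqxx pmulr_lge0 // ltr0n; have := ltn_ord j; lia.
- move=> i i' j j' ij ij' ii'; have [ie|ie] := eqVneq i i'.
    by have -> : j' = j by [apply: val_inj; rewrite /= -ij -ij' ie]; rewrite ie.
  have := maxN _ _ (tperm_mx_orthogonal R i i') (tperm_mx_orthogonal R j j').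
  rewrite -xrowE -xcolE !DN -subr_ge0 -sumrB.
  have jj' : j != j'.
    by apply: contra ie => /eqP jj; apply/eqP/val_inj; rewrite /= ij ij' jj.
  (* Only the rows [i] and [i'] see the swap, and they contribute
     [(D i j - D i' j') * (N i j - N i' j')] together. *)
  have rowE (a : 'I_p) (b : 'I_q) : a = b :> nat ->
      \sum_l D a l * N a l - \sum_l D a l * (xcol j j' (xrow i i' N)) a l
      = D a b * (N a b - N (tperm i i' a) (tperm j j' b)).
    move=> ab; rewrite -sumrB (bigD1 b) //= big1 ?addr0 ?mxE ?mulrBr // => l lb.
    rewrite !mxE; case: eqP => [al|_]; last by rewrite !mul0r subrr.
    by case/eqP: lb; apply: val_inj; rewrite /= -al.
  have row0 (a : 'I_p) : a != i -> a != i' ->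
      \sum_l D a l * N a l - \sum_l D a l * (xcol j j' (xrow i i' N)) a l = 0.
    move=> ai ai'; rewrite -sumrB; apply: big1 => b _; rewrite -mulrBr !mxE.
    case: eqP => [ab|_]; last by rewrite mul0r.
    rewrite !tpermD ?subrr ?mulr0 // 1?eq_sym //.
    - by apply: contra ai => /eqP jb; apply/eqP/val_inj; rewrite /= ab jb ij.
    - by apply: contra ai' => /eqP jb; apply/eqP/val_inj; rewrite /= ab jb ij'.
  have ie' : i' != i by rewrite eq_sym.
  rewrite (bigD1 i) //= (bigD1 i') //=.
  rewrite [X in _ + (_ + X)]big1; last by move=> a /andP[]; exact: row0.
  rewrite (rowE i j) // (rowE i' j') // !tpermL !tpermR addr0.
  rewrite -[N i' j' - _]opprB mulrN -mulrBl pmulr_rge0 ?subr_ge0 // subr_gt0.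
  rewrite !mxE ij ij' !eqxx ltr_nat.
  by have := ltn_ord j'; have : (j != j' :> nat)%N := jj'; lia.
Qed.

(** * Existence of singular value decompositions *)

Definition mx_continuous (R : realType) (T : topologicalType) (p q : nat)
    (f : T -> 'M[R]_(p, q)) : Prop :=
  forall i j, continuous (fun x => f x i j).

Lemma mx_continuous_tr (R : realType) (T : topologicalType) (p q : nat)
    (f : T -> 'M[R]_(p, q)) :
  mx_continuous f -> mx_continuous (fun x => (f x)^T).
Proof.
move=> cf i j; rewrite (_ : (fun x => _) = fun x => f x j i); first exact: cf.
by apply/funext => x; rewrite mxE.
Qed.

Lemma mx_continuous_cst (R : realType) (T : topologicalType) (p q : nat)
    (M : 'M[R]_(p, q)) : mx_continuous (fun _ : T => M).
Proof. by move=> i j; exact: cst_continuous. Qed.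

Lemma continuous_bigsum (R : realType) (T : topologicalType) (I : finType)
    (f : I -> T -> R) :
  (forall i, continuous (f i)) -> continuous (fun x => \sum_i f i x).
Proof.
move=> cf x; elim: (index_enum I) => [|i s ihs].
  under [X in continuous_at _ X]funext do rewrite big_nil.
  exact: cst_continuous.
under [X in continuous_at _ X]funext do rewrite big_cons.
by apply: continuousD => //; exact: cf.
Qed.

Lemma mx_continuousM (R : realType) (T : topologicalType) (p q s : nat)
    (f : T -> 'M[R]_(p, q)) (g : T -> 'M[R]_(q, s)) :
  mx_continuous f -> mx_continuous g -> mx_continuous (fun x => f x *m g x).
Proof.
move=> cf cg i j.
under [X in continuous X]funext do rewrite mxE.
by apply: continuous_bigsum => l x; apply: continuousM; [exact: cf|exact: cg].
Qed.

Lemma orthogonal_mx_entry (R : realType) (p : nat) (U : 'M[R]_p) i j :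
  orthogonal_mx U -> U i j \in `[-1, 1].
Proof.
move/matrixP/(_ j j); rewrite !mxE eqxx mulr1n (bigD1 i) //= !mxE -expr2 => H.
rewrite in_itv /= -ler_norml -(@expr_le1 _ 2) // -normrX ger0_norm ?sqr_ge0 //.
rewrite -H lerDl; apply: sumr_ge0 => l _.
by rewrite !mxE -expr2 sqr_ge0.
Qed.

Section Compactness.
Local Open Scope classical_set_scope.

Lemma closed_mx_eq (R : realType) (T : topologicalType) (p q : nat)
    (f : T -> 'M[R]_(p, q)) (M : 'M[R]_(p, q)) :
  mx_continuous f -> closed [set x | f x = M].
Proof.
move=> cf.
rewrite (_ : [set x | _] = \bigcap_(ij in [set: 'I_p * 'I_q])
   ((fun x => f x ij.1 ij.2) @^-1` [set M ij.1 ij.2])).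
  apply: closed_bigI => -[i j] _; apply: preimage_closed; last exact: closed_eq.
  by move=> x _; exact: cf.
apply/seteqP; split => [x /= fxM ij _|x /= H]; first by rewrite -fxM.
by apply/matrixP => i j; have := H (i, j) I.
Qed.

(** A pair of square matrices is encoded as one row vector, inside the
    compact box of row vectors with entries between [-1] and [1]. *)
Lemma svd_exists (R : realType) (p q : nat) (M : 'M[R]_(p, q)) :
  exists U V, [/\ orthogonal_mx U, orthogonal_mx V
                & singular_value_mx (U^T *m M *m V)].
Proof.
pose U (x : 'rV[R]_(p * p + q * q)) : 'M_p := vec_mx (lsubmx x).
pose V (x : 'rV[R]_(p * p + q * q)) : 'M_q := vec_mx (rsubmx x).
pose A := [set x | (U x)^T *m U x = 1%:M] `&` [set x | (V x)^T *m V x = 1%:M].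
have cU : mx_continuous U.
  move=> i j; under [X in continuous X]funext do rewrite !mxE.
  exact: coord_continuous.
have cV : mx_continuous V.
  move=> i j; under [X in continuous X]funext do rewrite !mxE.
  exact: coord_continuous.
have UVK (P : 'M_p) (Q : 'M_q) :
    U (row_mx (mxvec P) (mxvec Q)) = P /\ V (row_mx (mxvec P) (mxvec Q)) = Q.
  by rewrite /U /V row_mxKl row_mxKr !mxvecK.
have cA : compact (A : set 'rV[R]_(p * p + q * q)).
  apply: (@subclosed_compact _ _ [set x : 'rV[R]_(p * p + q * q) |
    forall i, x ord0 i \in `[-1, 1]%R]).
  - apply: closedI; apply: closed_mx_eq; apply: mx_continuousM => //;
      exact: mx_continuous_tr.
  - apply: (@rV_compact _ _ (fun=> `[(-1 : R), 1]%classic)) => _.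
    exact: segment_compact.
  - move=> x [oU oV] i /=; case: (splitP i) => l il.
      have -> : x ord0 i = lsubmx x ord0 l.
        by rewrite mxE; congr (x _ _); apply: val_inj.
      case/mxvec_indexP: l {il} => a b.
      have -> : lsubmx x ord0 (mxvec_index a b) = U x a b by rewrite [RHS]mxE.
      exact: (orthogonal_mx_entry _ _ oU).
    have -> : x ord0 i = rsubmx x ord0 l.
      by rewrite mxE; congr (x _ _); apply: val_inj.
    case/mxvec_indexP: l {il} => a b.
    have -> : rsubmx x ord0 (mxvec_index a b) = V x a b by rewrite [RHS]mxE.
    exact: (orthogonal_mx_entry _ _ oV).
pose f x := \tr ((weight_mx R p q)^T *m ((U x)^T *m M *m V x)).
have cf : continuous f.
  apply: continuous_bigsum => i.
  suff: mx_continuous (fun x =>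
    (weight_mx R p q)^T *m ((U x)^T *m M *m V x)) by exact.
  apply: mx_continuousM; first exact: mx_continuous_cst.
  apply: mx_continuousM => //.
  apply: mx_continuousM; last exact: mx_continuous_cst.
  exact: mx_continuous_tr.
have [|x xA maxf] := EVT_max_rV _ cA (continuous_subspaceT cf).
  exists (row_mx (mxvec 1%:M) (mxvec 1%:M)); rewrite /A /=.
  by have [-> ->] := UVK 1%:M 1%:M; rewrite !trmx1 !mulmx1.
move: xA; rewrite inE => -[/= oU oV].
exists (U x), (V x); split => //.
apply: trace_max_singular_value_mx => Q Q' oQ oQ'.
have := maxf (row_mx (mxvec (U x *m Q^T)) (mxvec (V x *m Q'))).
rewrite /f; have [-> ->] := UVK (U x *m Q^T) (V x *m Q').
rewrite trmx_mul trmxK !mulmxA; apply; rewrite inE /A /=.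
have [-> ->] := UVK (U x *m Q^T) (V x *m Q').
split; apply: orthogonal_mxM => //.
exact: orthogonal_mx_tr.
Qed.

End Compactness.

(** * Best approximations of bounded rank *)

Definition sqnorm (R : realType) (p q : nat) (M : 'M[R]_(p, q)) : R :=
  \sum_i \sum_j M i j ^+ 2.

Lemma sqnorm_ge0 (R : realType) (p q : nat) (M : 'M[R]_(p, q)) : 0 <= sqnorm M.
Proof. by apply: sumr_ge0 => i _; apply: sumr_ge0 => j _; exact: sqr_ge0. Qed.

Lemma sqnorm_eq0 (R : realType) (p q : nat) (M : 'M[R]_(p, q)) :
  sqnorm M = 0 -> M = 0.
Proof.
move=> M0; apply/matrixP => i j; rewrite mxE; apply/eqP; rewrite -sqrf_eq0.
have M0i : \sum_j M i j ^+ 2 == 0.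
  move/eqP: M0; rewrite psumr_eq0 => [/allP/(_ i)|a _]; last first.
    by apply: sumr_ge0 => b _; exact: sqr_ge0.
  by rewrite mem_index_enum => /(_ isT).
move: M0i; rewrite psumr_eq0 => [/allP/(_ j)|b _]; last exact: sqr_ge0.
by rewrite mem_index_enum => /(_ isT).
Qed.

Lemma frobenius_norm_sqr (R : realType) (p q : nat) (M : 'M[R]_(p, q)) :
  frobenius_norm M ^+ 2 = sqnorm M.
Proof. by rewrite sqr_sqrtr // sqnorm_ge0. Qed.

Lemma sqnorm_trace (R : realType) (p q : nat) (M : 'M[R]_(p, q)) :
  sqnorm M = \tr (M^T *m M).
Proof.
rewrite mxtrace_mulC; apply: eq_bigr => i _; rewrite mxE.
by apply: eq_bigr => j _; rewrite mxE expr2.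
Qed.

Lemma sqnorm_orthogonal (R : realType) (p q : nat) (U : 'M[R]_p) (V : 'M[R]_q)
    (M : 'M[R]_(p, q)) :
  orthogonal_mx U -> orthogonal_mx V -> sqnorm (U *m M *m V^T) = sqnorm M.
Proof.
move=> oU oV; rewrite !sqnorm_trace !trmx_mul trmxK mxtrace_mulC.
rewrite !mulmxA. rewrite -[_ *m V^T *m V]mulmxA oV mulmx1 mxtrace_mulC.
rewrite !mulmxA. by rewrite oU mul1mx mxtrace_mulC.
Qed.

Lemma sqnorm_perp (R : realType) (p q : nat) (M N : 'M[R]_(p, q)) :
  M^T *m N = 0 -> sqnorm (M + N) = sqnorm M + sqnorm N.
Proof.
move=> MN0.
have NM0 : N^T *m M = 0 by rewrite -[LHS]trmxK trmx_mul trmxK MN0 trmx0.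
rewrite !sqnorm_trace [(M + N)^T]raddfD /= mulmxDl !mulmxDr MN0 NM0 addr0 add0r.
by rewrite linearD.
Qed.

Definition best_approx (R : realType) (p q s : nat)
    (B H : 'M[R]_(p, q)) : Prop :=
  (\rank H <= s)%N /\
  forall Z, (\rank Z <= s)%N -> sqnorm (B - H) <= sqnorm (B - Z).

Definition unique_best_approx (R : realType) (p q s : nat)
    (B H : 'M[R]_(p, q)) : Prop :=
  (\rank H <= s)%N /\
  forall Z, (\rank Z <= s)%N -> sqnorm (B - Z) <= sqnorm (B - H) -> Z = H.

Lemma best_approx_orthogonal (R : realType) (p q s : nat)
    (U : 'M[R]_p) (V : 'M[R]_q) (B H : 'M[R]_(p, q)) :
  orthogonal_mx U -> orthogonal_mx V ->
  best_approx s B H -> best_approx s (U *m B *m V^T) (U *m H *m V^T).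
Proof.
move=> oU oV [rH minH].
have rk P Q (Z : 'M[R]_(p, q)) :
    (\rank Z <= s)%N -> (\rank (P *m Z *m Q) <= s)%N.
  move=> rZ; apply: leq_trans rZ; apply: leq_trans (mxrankM_maxl _ _) _.
  exact: mxrankM_maxr.
split=> [|Z rZ]; first exact: rk.
have -> : Z = U *m (U^T *m Z *m V) *m V^T.
  rewrite !mulmxA orthogonal_mxV // mul1mx -mulmxA.
  by rewrite orthogonal_mxV // mulmx1.
rewrite -!mulmxBl -!mulmxBr !sqnorm_orthogonal //; exact/minH/rk.
Qed.

(** The tie-breaking step. For [Z = 2 Y], the parallelogram identity writes the
    error [|B + H - 2 Y|^2] as [2 |B - Y|^2 + 2 |H - Y|^2 - |B - H|^2], which is
    at least [|B - H|^2 + 2 |H - Y|^2] by optimality of [H]. *)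
Lemma best_approx_double (R : realType) (p q s : nat) (B H : 'M[R]_(p, q)) :
  best_approx s B H -> unique_best_approx s (B + H) (2 *: H).
Proof.
move=> [rH minH]; split=> [|Z rZ].
  by rewrite mxrank_scale_nz // pnatr_eq0.
pose Y := 2^-1 *: Z.
have ZY : Z = 2 *: Y by rewrite /Y scalerA divff ?scale1r // pnatr_eq0.
have rY : (\rank Y <= s)%N by rewrite mxrank_scale_nz // invr_eq0 pnatr_eq0.
have parallelogram : sqnorm (B + H - 2 *: Y)
    = 2 * sqnorm (B - Y) + 2 * sqnorm (H - Y) - sqnorm (B - H).
  rewrite /sqnorm !mulr_sumr -big_split /= -sumrB; apply: eq_bigr => i _.
  rewrite !mulr_sumr -big_split /= -sumrB; apply: eq_bigr => j _.
  by rewrite !mxE; ring.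
have -> : B + H - 2 *: H = B - H.
  by rewrite scaler_nat mulr2n opprD addrA addrK.
rewrite ZY parallelogram => le_Y.
have HY0 : sqnorm (H - Y) = 0.
  by apply/eqP; rewrite eq_le sqnorm_ge0 andbT; have := minH _ rY; lra.
by have /eqP := sqnorm_eq0 HY0; rewrite subr_eq0 => /eqP ->.
Qed.

Lemma mxrank_nonzero_rows (R : realType) (p q : nat) (A : {set 'I_p})
    (M : 'M[R]_(p, q)) :
  (forall i j, i \notin A -> M i j = 0) -> (\rank M <= #|A|)%N.
Proof.
move=> M0.
have le_sum : (M <= \sum_(i in A) <<row i M>>)%MS.
  apply/row_subP => i; have [iA|iA] := boolP (i \in A).
    by rewrite (sumsmx_sup i) // genmxE.
  rewrite (_ : row i M = 0) ?sub0mx //.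
  by apply/rowP => j; rewrite !mxE M0.
apply: leq_trans (mxrankS le_sum) _.
apply: leq_trans (mxrank_sum_leqif _) _ => /=; rewrite -sum1_card.
by apply: leq_sum => i _; rewrite mxrank_gen rank_leq_row.
Qed.

(** The rows and columns that carry a nonzero diagonal entry cut out an
    invertible diagonal submatrix. *)
Lemma mxrank_diag_ge (R : realType) (p q : nat) (M : 'M[R]_(p, q)) :
    is_diag_mx M ->
  (#|[set i : 'I_p | [exists j : 'I_q, (M i j != 0)%R]]| <= \rank M)%N.
Proof.
move/is_diag_mxP => diagM; set A := [set i | _].
have /= Aj (k : 'I_#|A|) : exists j : 'I_q, M (enum_val k) j != 0.
  by have := enum_valP k; rewrite inE => /existsP.
pose g k := xchoose (Aj k).
have gP k : M (enum_val k) (g k) != 0 by exact: xchooseP (Aj k).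
have gE k : g k = enum_val k :> nat.
  by apply/eqP; apply: contraNT (gP k) => ne; rewrite diagM // eq_sym.
pose f (k : 'I_#|A|) := enum_val k.
have rkA : \rank (mxsub f g M) = #|A|.
  apply: mxrank_unit.
  have -> : mxsub f g M = diag_mx (\row_k M (enum_val k) (g k)).
    apply/matrixP => k l; rewrite !mxE; have [->|kl] := eqVneq k l.
      by rewrite mulr1n.
    rewrite mulr0n diagM // gE; apply: contra kl => /eqP ekl.
    by apply/eqP/enum_val_inj/val_inj.
  rewrite unitmxE det_diag unitfE; apply/prodf_neq0 => k _.
  by rewrite mxE; exact: gP.
rewrite -rkA -[M in mxsub _ _ M]mul1mx mxsub_mul.
apply: leq_trans (mxrankM_maxr _ _) _.
rewrite -[M in colsub _ M]mulmx1 mxsub_mul.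
by apply: leq_trans (mxrankM_maxl _ _) _; rewrite mxsub_id.
Qed.

(** Discarding all but [s] terms of a nonincreasing family costs least when the
    first [s] are kept. *)
Lemma rearrangement (R : realType) (p s : nat) (e : 'I_p -> R)
    (A : {set 'I_p}) :
    (forall i, 0 <= e i) -> (forall i i' : 'I_p, (i <= i')%N -> e i' <= e i) ->
    (#|A| <= s)%N ->
  \sum_(i < p | (s <= i)%N) e i <= \sum_(i < p | i \notin A) e i.
Proof.
move=> e_ge0 e_mono cA; have [ps|sp] := leqP p s.
  rewrite big_pred0 ?sumr_ge0 // => i.
  by apply/negbTE; rewrite -ltnNge (leq_trans (ltn_ord i) ps).
(* After subtracting the threshold [t], the terms of index at least [s] are
   nonpositive and the others nonnegative, which leaves a comparison of the
   numbers of terms. *)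
pose t := e (Ordinal sp).
have shift (P : pred 'I_p) :
   \sum_(i | P i) e i = \sum_(i | P i) (e i - t) + #|P|%:R * t.
  rewrite mulr_natl -sumr_const -big_split.
  by apply: eq_bigr => i _ /=; rewrite subrK.
rewrite !shift; apply: lerD.
  rewrite [leRHS](bigID (fun i : 'I_p => (s <= i)%N)) /=.
  rewrite [leLHS](bigID (fun i => i \notin A)) /=.
  under [X in X + _ <= _]eq_bigl do rewrite andbC.
  rewrite lerD2l (@le_trans _ _ 0) //.
    apply: sumr_le0 => i /andP[si _]; rewrite subr_le0; exact: e_mono.
  apply: sumr_ge0 => i /andP[_]; rewrite -ltnNge subr_ge0 => /ltnW is_.
  exact: e_mono.
apply: ler_wpM2r; first exact: e_ge0.
have cardS : #|[pred i : 'I_p | (i < s)%N]| = s.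
  by rewrite -sum1_card (big_ord_narrow (ltnW sp)) /= sum1_card card_ord.
have := cardC [pred i : 'I_p | (i < s)%N]; have := cardC A.
rewrite cardS card_ord => eA eS; rewrite ler_nat.
have -> : #|(fun i : 'I_p => (s <= i)%N)|
    = #|[predC [pred i : 'I_p | (i < s)%N]]|.
  by apply: eq_card => i; rewrite !inE -leqNgt.
have -> : #|(fun i : 'I_p => i \notin A)| = #|[predC A]| by apply: eq_card.
by rewrite -(leq_add2l s) eS -[X in (X <= _)%N]eA leq_add2r.
Qed.

(** * The equality case of the Eckart-Young theorem *)

Lemma card_ord_lt (p s : nat) : (#|[set i : 'I_p | (i < s)%N]| <= s)%N.
Proof.
have [ps|sp] := leqP p s.
  by apply: leq_trans (max_card _) _; rewrite card_ord.
by rewrite cardsE -sum1_card (big_ord_narrow (ltnW sp)) /= sum1_card card_ord.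
Qed.

Lemma mxrank_truncate_diag (R : realType) (p q s : nat) (S : 'M[R]_(p, q)) :
  (\rank (truncate_diag s S) <= s)%N.
Proof.
apply: leq_trans (card_ord_lt p s).
by apply: mxrank_nonzero_rows => i j; rewrite inE mxE => /negPf->.
Qed.

(** Changing the signs of row [a] and column [a] preserves [S], the rank and
    the norm, so by uniqueness it preserves [G]; but it negates the off-diagonal
    entries of row [a]. *)
Lemma unique_best_approx_diag (R : realType) (p q s : nat)
    (S G : 'M[R]_(p, q)) :
  is_diag_mx S -> unique_best_approx s S G -> is_diag_mx G.
Proof.
move=> /is_diag_mxP diagS [rG uniqG]; apply/is_diag_mxP => a b ab.
pose Z := diag_mx (\row_i (-1) ^+ (i == a :> nat)) *m G
          *m diag_mx (\row_j (-1) ^+ (j == a :> nat)).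
have ZE i j : Z i j = (-1) ^+ (i == a :> nat) * G i j * (-1) ^+ (j == a :> nat).
  by rewrite /Z mul_mx_diag mul_diag_mx !mxE.
have rZ : (\rank Z <= s)%N.
  apply: leq_trans rG; apply: leq_trans (mxrankM_maxl _ _) _.
  exact: mxrankM_maxr.
clearbody Z; have /matrixP/(_ a b) : Z = G.
  apply: uniqG => //.
  rewrite le_eqVlt; apply/orP; left; apply/eqP.
  apply: eq_bigr => i _; apply: eq_bigr => j _.
  rewrite !mxE ZE; have [ij|ij] := eqVneq (i : nat) j.
    by rewrite -ij mulrAC -signr_addb addbb mul1r.
  by rewrite diagS // !sub0r !sqrrN !exprMn !sqrr_sign mul1r mulr1.
rewrite ZE eqxx eq_sym (negPf ab) expr0 expr1 mulr1 mulN1r => GN.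
by lra.
Qed.

Lemma singular_value_rows (R : realType) (p q : nat) (S : 'M[R]_(p, q))
    (i i' : 'I_p) :
  singular_value_mx S -> (i <= i')%N ->
  \sum_j S i' j ^+ 2 <= \sum_j S i j ^+ 2.
Proof.
move=> [/is_diag_mxP diagS S_ge0 S_mono] ii'.
have [iq|qi] := ltnP i' q; last first.
  rewrite big1 => [|j _]; first by apply: sumr_ge0 => j _; exact: sqr_ge0.
  by rewrite diagS ?expr0n //; have := ltn_ord j; lia.
have iq' := leq_ltn_trans ii' iq.
rewrite (bigD1 (Ordinal iq)) //= [leRHS](bigD1 (Ordinal iq')) //=.
rewrite !big1 ?addr0; first last.
- move=> j jn; rewrite diagS ?expr0n //; apply: contra jn => /eqP ij.
  by apply/eqP/val_inj.
- move=> j jn; rewrite diagS ?expr0n //; apply: contra jn => /eqP ij.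
  by apply/eqP/val_inj.
by rewrite ler_pXn2r ?nnegrE ?S_ge0 //; apply: S_mono.
Qed.

(** [G] is diagonal with at most [s] nonzero entries, so its error is at least
    the sum of the squares of the entries of [S] in the other rows, and the
    truncation does at least as well. *)
Lemma unique_best_approx_truncate (R : realType) (p q s : nat)
    (S G : 'M[R]_(p, q)) :
  singular_value_mx S -> unique_best_approx s S G -> G = truncate_diag s S.
Proof.
move=> svS bestG; have [diagS _ _] := svS.
have diagG := unique_best_approx_diag diagS bestG.
have rkA := mxrank_diag_ge diagG.
set A := [set i | _] in rkA.
case: bestG => rG uniqG; symmetry.
apply: uniqG; first exact: mxrank_truncate_diag.
pose e i := \sum_j S i j ^+ 2.
have e_ge0 i : 0 <= e i by apply: sumr_ge0 => j _; exact: sqr_ge0.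
have truncE : sqnorm (S - truncate_diag s S) = \sum_(i < p | (s <= i)%N) e i.
  rewrite [RHS]big_mkcond /=; apply: eq_bigr => i _; case: leqP => si.
    by apply: eq_bigr => j _; rewrite !mxE ltnNge si subr0.
  by apply: big1 => j _; rewrite !mxE si subrr expr0n.
rewrite truncE; apply: le_trans (rearrangement (A := A) e_ge0 _ _) _.
- by move=> i i'; exact: singular_value_rows.
- exact: leq_trans rkA rG.
rewrite big_mkcond /=; apply: ler_sum => i _; case: ifP => [iA|_]; last first.
  by apply: sumr_ge0 => j _; exact: sqr_ge0.
rewrite le_eqVlt; apply/orP; left; apply/eqP.
apply: eq_bigr => j _; rewrite !mxE.
suff -> : G i j = 0 by rewrite subr0.
apply/eqP; apply: contraTT iA => Gij.
by rewrite inE negbK; apply/existsP; exists j.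
Qed.

(** Otherwise keeping row [i'] of [S] instead of row [i] would reduce the error
    without raising the rank. *)
Lemma best_approx_truncate_le (R : realType) (p q s : nat) (S : 'M[R]_(p, q))
    (i i' : 'I_p) (j j' : 'I_q) :
    is_diag_mx S -> best_approx s S (truncate_diag s S) ->
    i = j :> nat -> i' = j' :> nat -> (i < s <= i')%N ->
  S i' j' ^+ 2 <= S i j ^+ 2.
Proof.
move=> /is_diag_mxP diagS [_ minT] ij ij' /andP[is_ si'].
pose A := i' |: ([set a : 'I_p | (a < s)%N] :\ i).
have cA : (#|A| <= s)%N.
  have i's : i' \notin [set a : 'I_p | (a < s)%N] :\ i.
    by rewrite !inE ltnNge si' andbF.
  rewrite cardsU1 i's; have := card_ord_lt p s.
  by rewrite (cardsD1 i) inE is_.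
pose Y : 'M[R]_(p, q) := \matrix_(a, b) if a \in A then S a b else 0.
have /minT : (\rank Y <= s)%N.
  apply: leq_trans cA; apply: mxrank_nonzero_rows => a b /negPf aA.
  by rewrite mxE aA.
have ne : i' != i by rewrite -val_eqE neq_ltn (leq_trans is_ si') orbT.
have rowE (a : 'I_p) (b : 'I_q) :
    a = b :> nat -> \sum_l S a l ^+ 2 = S a b ^+ 2.
  move=> ab; rewrite (bigD1 b) //= big1 ?addr0 // => l lb.
  rewrite diagS ?expr0n //; apply: contra lb => /eqP al.
  by apply/eqP/val_inj; rewrite /= -al.
rewrite /sqnorm (bigD1 i) //= (bigD1 i') //= [leRHS](bigD1 i) //=.
rewrite [X in _ <= _ + X](bigD1 i') //=.
rewrite [X in X + _ <= _]big1; last first.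
  by move=> b _; rewrite !mxE is_ subrr expr0n.
rewrite [X in _ + (X + _) <= _](eq_bigr (fun b => S i' b ^+ 2)); last first.
  by move=> b _; rewrite !mxE ltnNge si' subr0.
rewrite (rowE i' j') //.
rewrite [X in _ <= X + _](eq_bigr (fun b => S i b ^+ 2)); last first.
  by move=> b _; rewrite !mxE !inE eqxx eq_sym (negPf ne) subr0.
rewrite (rowE i j) // [X in _ <= _ + (X + _)]big1; last first.
  by move=> b _; rewrite !mxE !inE eqxx subrr expr0n.
set T1 := (X in 0 + (_ + X)); set T2 := (X in _ <= _ + (0 + X)).
suff -> : T1 = T2 by lra.
apply: eq_bigr => a /andP[ai ai']; apply: eq_bigr => b _.
by rewrite !mxE !inE (negPf ai) (negPf ai').
Qed.

(** Equality case of the Eckart-Young theorem. The decomposition comes from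
    [B + H] rather than from [B], since an arbitrary one of [B] need not
    truncate to [H] when singular values are tied. *)
Theorem best_approx_hard_threshold (R : realType) (p q s : nat)
    (B H : 'M[R]_(p, q)) :
  best_approx s B H -> hard_threshold s B H.
Proof.
move=> bestH.
have [U [V [oU oV svS]]] := svd_exists (B + H).
have oUt := orthogonal_mx_tr oU; have oVt := orthogonal_mx_tr oV.
have := best_approx_orthogonal oUt oVt bestH; rewrite trmxK.
move: svS; rewrite mulmxDr mulmxDl.
move defB' : (U^T *m B *m V) => B'.
move defH' : (U^T *m H *m V) => H' svS bestH'.
have double : 2 *: H' = truncate_diag s (B' + H').
  exact: unique_best_approx_truncate svS (best_approx_double bestH').
have H'E i j : H' i j = if (i < s)%N then B' i j else 0.
  move/matrixP/(_ i j): double; rewrite !mxE; case: ltnP => _; lra.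
(* In the rotated bases [B' + H' = S] and [2 H'] is the truncation of [S]. *)
have B'E i j : B' i j = if (i < s)%N then (B' + H') i j / 2 else (B' + H') i j.
  by rewrite mxE H'E; case: ltnP => _; lra.
have truncB' : H' = truncate_diag s B' by apply/matrixP => i j; rewrite H'E mxE.
have [/is_diag_mxP diagS S_ge0 S_mono] := svS.
have diagB' : is_diag_mx B'.
  apply/is_diag_mxP => i j ij; rewrite B'E; case: ifP => _; rewrite diagS //.
  by rewrite mul0r.
have B'_ge0 (i : 'I_p) (j : 'I_q) : i = j :> nat -> 0 <= B' i j.
  move=> ij; have := S_ge0 _ _ ij; rewrite B'E; case: ltnP => _; lra.
have back (M : 'M[R]_(p, q)) : M = U *m (U^T *m M *m V) *m V^T.
  rewrite !mulmxA orthogonal_mxV // mul1mx -mulmxA.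
  by rewrite orthogonal_mxV // mulmx1.
exists U, B', V; split; last by rewrite -truncB' -defH'; exact: back.
split=> //; last by rewrite -defB'; exact: back.
move=> i i' j j' ij ij' ii'.
have := S_mono _ _ _ _ ij ij' ii'.
case: (ltnP i' s) => i's.
  by rewrite (B'E i) (B'E i') i's (leq_ltn_trans ii' i's); lra.
case: (ltnP i s) => is_; last first.
  by rewrite (B'E i) (B'E i') !ltnNge i's is_.
move=> _; rewrite -(@ler_pXn2r _ 2) ?nnegrE ?B'_ge0 //.
apply: (@best_approx_truncate_le _ _ _ s) => //; last by rewrite is_ i's.
by rewrite -truncB'.
Qed.

(** * Orthogonal decomposition along a column space *)

(** A vector in both row spaces is orthogonal to itself. *)
Lemma col_kermx_cap0 (R : realType) (m p a b : nat) (X : 'M[R]_(m, p))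
    (Y : 'M[R]_(a, m)) (Z : 'M[R]_(b, m)) :
  (Y <= X^T)%MS -> Z *m X = 0 -> (Y :&: Z)%MS = 0.
Proof.
move=> YX ZX0; apply/eqP; rewrite -submx0; apply/rV_subP => u.
rewrite sub_capmx => /andP[/submx_trans/(_ YX)/submxP[v uE] /submxP[w wE]].
suff -> : u = 0 by exact: sub0mx.
suff u0 : sqnorm u = 0 by exact: sqnorm_eq0.
rewrite sqnorm_trace mxtrace_mulC {2}uE trmx_mul trmxK wE mulmxA.
rewrite -[w *m Z *m X]mulmxA.
by rewrite ZX0 mulmx0 mul0mx mxtrace0.
Qed.

(** The two spaces meet trivially and their dimensions add up to [m], so they
    are complementary and [proj_mx] decomposes every vector along them. *)
Lemma proj_colP (R : realType) (m p q : nat) (X : 'M[R]_(m, p))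
    (M : 'M[R]_(m, q)) :
  [/\ M = proj_col X M + proj_col_perp X M,
      exists L, proj_col X M = X *m L
    & X^T *m proj_col_perp X M = 0].
Proof.
have cap0 : (<<X^T>> :&: kermx X)%MS = 0.
  by apply: (@col_kermx_cap0 _ _ _ _ _ X); [rewrite genmxE|exact: mulmx_ker].
have full : (1%:M <= <<X^T>> + kermx X)%MS.
  rewrite sub1mx /row_full mxrank_disjoint_sum // genmxE mxrank_tr mxrank_ker.
  by rewrite subnKC // rank_leq_row.
split.
- rewrite -[LHS]trmxK /proj_col /proj_col_perp -linearD /=; congr trmx.
  by rewrite add_proj_mx // (submx_trans (submx1 _)).
- have /submxP[L LE] : (M^T *m proj_mx <<X^T>>%MS (kermx X) <= X^T)%MS.
    by rewrite -(genmxE X^T) proj_mx_sub.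
  by exists L^T; rewrite /proj_col LE trmx_mul trmxK.
- rewrite -trmx_mul -[RHS]trmx0; congr trmx; apply/sub_kermxP.
  exact: proj_mx_sub.
Qed.

(** Column operations remove [X *m L]. *)
Lemma mxrank_row_mx_shear (R : realType) (m p q : nat) (X : 'M[R]_(m, p))
    (L : 'M[R]_(p, q)) (Z : 'M[R]_(m, q)) :
  \rank (row_mx X (X *m L + Z)) = \rank (X^T + Z^T)%MS.
Proof.
rewrite -mxrank_tr tr_row_mx -addsmxE [(_ + Z)^T]raddfD /= trmx_mul.
apply: eqmx_rank; apply/andP; split; rewrite addsmx_sub addsmxSl /=.
  by rewrite addmx_sub ?addsmxSr // mulmx_sub // addsmxSl.
rewrite -[Z^T in X in (X <= _)%MS](addKr (L^T *m X^T)) addmx_sub ?addsmxSr //.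
by rewrite eqmx_opp mulmx_sub // addsmxSl.
Qed.

Lemma mxrank_row_mx_le (R : realType) (m p q : nat) (X : 'M[R]_(m, p))
    (L : 'M[R]_(p, q)) (Z : 'M[R]_(m, q)) :
  (\rank (row_mx X (X *m L + Z)) <= \rank X + \rank Z)%N.
Proof.
rewrite mxrank_row_mx_shear -(mxrank_tr X) -(mxrank_tr Z).
exact: mxrank_adds_leqif.
Qed.

Lemma mxrank_row_mx_perp (R : realType) (m p q : nat) (X : 'M[R]_(m, p))
    (L : 'M[R]_(p, q)) (Z : 'M[R]_(m, q)) :
  X^T *m Z = 0 -> \rank (row_mx X (X *m L + Z)) = (\rank X + \rank Z)%N.
Proof.
move=> XZ0; rewrite mxrank_row_mx_shear mxrank_disjoint_sum ?mxrank_tr //.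
apply: (@col_kermx_cap0 _ _ _ _ _ X) => //.
by rewrite -[X in _ *m X]trmxK -trmx_mul XZ0 trmx0.
Qed.

(** * Optimal second block *)

Theorem theorem2 (R : realType) (m n k r : nat)
    (m_gt0 : (0 < m)%N) (n_gt0 : (0 < n)%N) (k_gt0 : (0 < k)%N)
    (r_gt0 : (0 < r)%N) (le_r_mn : (r <= minn m n)%N) (lt_k_r : (k < r)%N)
    (A1 : 'M[R]_(m, k)) (A2 : 'M[R]_(m, n - k)) (W1 : 'M[R]_(m, k))
    (W1_gt0 : forall (i : 'I_m) (j : 'I_k), 0 < W1 i j)
    (X1 : 'M[R]_(m, k)) (X2 : 'M[R]_(m, n - k))
    (X_sol : is_wlra_solution r A1 W1 A2 X1 X2)
    (X1_full : \rank X1 = k) :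
  exists2 H : 'M[R]_(m, n - k),
    hard_threshold (r - k) (proj_col_perp X1 A2) H
    & X2 = proj_col X1 A2 + H.
Proof.
case: X_sol => rX minX.
have [A2E [L LE] B0] := proj_colP X1 A2; rewrite LE in A2E *.
have [X2E [L2 L2E] H0] := proj_colP X1 X2; rewrite L2E in X2E.
set B := proj_col_perp X1 A2 in A2E B0 *.
set H := proj_col_perp X1 X2 in X2E H0.
have rH : (\rank H <= r - k)%N.
  have := rX; rewrite X2E mxrank_row_mx_perp // X1_full.
  by rewrite leq_subRL // ltnW.
have pythagoras : sqnorm (A2 - X2) = sqnorm (X1 *m (L - L2)) + sqnorm (B - H).
  rewrite -sqnorm_perp; last first.
    by rewrite trmx_mul mulmxBr -!mulmxA B0 H0 subrr.
  by rewrite A2E X2E mulmxBr opprD addrACA.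
have minB Z : (\rank Z <= r - k)%N -> sqnorm (A2 - X2) <= sqnorm (B - Z).
  move=> rZ; have /minX : (\rank (row_mx X1 (X1 *m L + Z)) <= r)%N.
    apply: leq_trans (mxrank_row_mx_le _ _ _) _.
    by rewrite X1_full -leq_subRL // ltnW.
  rewrite /wlra_cost lerD2l !frobenius_norm_sqr {2}A2E.
  by rewrite opprD addrACA subrr add0r.
(* The competitor [Z = H] differs from [X2] only in its component along [X1]. *)
have XL0 : X1 *m (L - L2) = 0.
  apply: sqnorm_eq0; apply/eqP; rewrite eq_le sqnorm_ge0 andbT.
  by have := minB _ rH; rewrite pythagoras gerDr.
exists H.
  apply: best_approx_hard_threshold; split=> // Z rZ.
  by apply: le_trans (minB Z rZ); rewrite pythagoras lerDr sqnorm_ge0.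
by rewrite X2E; move/eqP: XL0; rewrite mulmxBr subr_eq0 => /eqP ->.
Qed.
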